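(* Let $A=\{a_1,a_2,\ldots\}\subseteq\mathbb{Z}^+$, where the elements $a_i$ are written in increasing order $a_1<a_2<\cdots$ and satisfy $$2a_{s-1}+4a_{s-2}+6a_{s-3}+\cdots+2(s-1)a_1<a_s$$ for all $s\ge 2$ (that is, $\sum_{i=1}^{s-1}2i\,a_{s-i}<a_s$ for all $s\ge 2$). Then $P(m,n,A)\le F(n)$ for all positive integers $m,n$.
   Context: $\mathbb{Z}^+$ is the set of positive integers. For $A\subseteq\mathbb{Z}^+$ and positive integers $m,n$, $P(m,n,A)$ denotes the number of partitions of $m$ into at most $n$ parts from $A$, i.e. the number of ways to write $m=\alpha_1+\alpha_2+\cdots+\alpha_t$ with $t\le n$, $\alpha_1\le\alpha_2\le\cdots\le\alpha_t$, and all $\alpha_i\in A$ (not necessarily distinct). Equivalently, writing $A=\{a_1<a_2<\cdots\}$, it is the number of sequences $(x_i)$ of non-negative integers with $\sum_i x_ia_i=m$ and $\sum_i x_i\le n$. $F(n)$ is the $n$-th Fibonacci number: $F(1)=F(2)=1$, $F(n)=F(n-1)+F(n-2)$ for $n\ge 3$, and $F(i)=0$ for all integers $i\le 0$. *)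

(* Defs.v *)
From mathcomp Require Import all_boot.

Set Implicit Arguments.
Unset Strict Implicit.
Unset Printing Implicit Defensive.

(* The paper's F vanishes at all integers i <= 0; on nat only F 0 = 0 remains. *)
Fixpoint F (n : nat) : nat :=
  match n with
  | 0 => 0
  | n'.+1 => match n' with
             | 0 => 1
             | n''.+1 => F n' + F n''
             end
  end.

Definition is_partition (m : nat) (A : {pred nat}) (s : seq nat) : bool :=
  [&& sorted leq s, all [in A] s & sumn s == m].

(* Parts range over 'I_m.+1 only to have a finite type: a part of a partition
   of m is at most m. The index t is the exact number of parts. *)
Definition P (m n : nat) (A : {pred nat}) : nat :=
  \sum_(t < n.+1)
    #|[set s : t.-tuple 'I_m.+1 | is_partition m A [seq val i | i <- s]]|.

(* Indices start at 1; N is the number of elements of the set being enumerated,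
   with None for an infinite set. *)
Definition index_of (N : option nat) (s : nat) : bool :=
  (1 <= s) && (if N is Some k then s <= k else true).

(* A = {a_1 < a_2 < ...}, finite or infinite; values of a at other indices are
   irrelevant. *)
Definition increasing_enum (A : {pred nat}) (N : option nat) (a : nat -> nat)
    : Prop :=
  (forall x, x \in A <-> exists2 s, index_of N s & a s = x) /\
  (forall s t, index_of N s -> index_of N t -> s < t -> a s < a t).

(* Main.v *)
Require Import Defs.
From mathcomp Require Import all_boot.
From mathcomp Require Import zify.

Set Implicit Arguments.
Unset Strict Implicit.
Unset Printing Implicit Defensive.

(** Let [m > 0] and let [a s] be the largest element of [A] that is at most [m].
    A partition of [m] only uses the parts [a s, a (s - 1), ..., a 1].  If it
    used [a (s - i)] at most [2 * i] times for every [0 <= i < s], its sum would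
    be at most [\sum_(1 <= i < s) 2 * i * a (s - i) < a s <= m] (and it would be
    empty if [s = 1]).  So for some [i] it contains [2 * i + 1] copies of
    [a (s - i)] ([pigeonhole_part]); the case [i = 0] says that it contains
    [a s].

    Removing these copies is injective and leaves a partition of a smaller
    number into at most [n - (2 * i + 1)] parts ([size_remove_copies]).  By
    strong induction on [n], the number of partitions is at most
    [F (n - 1) + F (n - 3) + F (n - 5) + ...], and this sum telescopes to [F n].

    The delicate point is the empty partition of [0] into at most [0] parts,
    which is not counted by [F 0 = 0].  The induction is therefore carried out
    with [maxn 1 (F n)], which differs from [F n] only at [n = 0].  The sum still
    telescopes to [F n] ([sum_fib_bound]): a term of index [0] occurs only for
    odd [n], where [F (n - 1) + F (n - 3) + ... + F 2] equals [F n - 1]. *)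

(** * A telescoping Fibonacci sum *)

Lemma F_gt0 n : 0 < n -> 0 < F n.
Proof.
case: n => // n _; elim: n => // n IHn.
by rewrite -[F n.+2]/(F n.+1 + F n) addn_gt0 IHn.
Qed.

(** Agrees with [F n] except at [n = 0], where it accounts for the empty
    partition of [0]. *)
Definition fib_bound (n : nat) : nat := maxn 1 (F n).

Lemma fib_boundE n : 0 < n -> fib_bound n = F n.
Proof. by move=> /F_gt0 /maxn_idPr. Qed.

(** By [F n = F (n - 1) + F (n - 2)], removing the first term passes from [n] to
    [n - 2].  The sum may end with [fib_bound 0 = 1], which is [F 1]. *)
Lemma sum_fib_bound s n :
  \sum_(0 <= i < s | 2 * i < n) fib_bound (n - (2 * i).+1) <= F n.
Proof.
elim: s n => [|s IHs] n; first by rewrite big_nil.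
case: n => [|[|n]].
- by rewrite big1.
- by rewrite big_mkcond big_nat_recl // big1.
rewrite -[F n.+2]/(F n.+1 + F n) big_mkcond big_nat_recl //.
rewrite muln0 subn1 fib_boundE // leq_add2l.
apply: leq_trans (IHs n); rewrite [leqRHS]big_mkcond leq_sum // => i _.
have -> : (2 * i.+1 < n.+2) = (2 * i < n) by lia.
by have -> : n.+2 - (2 * i.+1).+1 = n - (2 * i).+1 by lia.
Qed.

(** * Sums and counts over sequences *)

Lemma sumn_le_counts (r t : seq nat) :
  {subset t <= r} -> sumn t <= \sum_(x <- r) count_mem x t * x.
Proof.
elim: t => [|y t IHt] // sub_r.
have yr : y \in r by apply: sub_r; rewrite mem_head.
have /IHt IH : {subset t <= r}.
  by move=> x xt; apply: sub_r; rewrite inE xt orbT.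
rewrite /=; under eq_bigr do rewrite mulnDl.
rewrite big_split leq_add //= (big_rem y) //= eqxx mul1n.
exact: leq_addr.
Qed.

(** A union bound: a member of [L] that satisfies several [Q i] is counted
    several times on the right. *)
Lemma size_le_sum_count (T I : Type) (L : seq T) (r : seq I) (Q : I -> pred T) :
  all (fun t => has (Q^~ t) r) L -> size L <= \sum_(i <- r) count (Q i) L.
Proof.
elim: L => [|t L IHL] //= /andP[Qt /IHL IH].
rewrite big_split -add1n leq_add //=.
by rewrite lt0n sum_nat_seq_neq0; under eq_has do rewrite eqb0 negbK.
Qed.

(** * Removing copies of a part *)

Definition partition_upto (m n : nat) (A : {pred nat}) (t : seq nat) : bool :=
  is_partition m A t && (size t <= n).

Lemma sorted_partition_inj m m' A s t :
  is_partition m A s -> is_partition m' A t -> perm_eq s t -> s = t.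
Proof.
move=> /and3P[s_sorted _ _] /and3P[t_sorted _ _].
exact: (sorted_eq leq_trans anti_leq).
Qed.

Lemma partition_upto_rem m n A v t :
  v \in t -> partition_upto m n.+1 A t -> partition_upto (m - v) n A (rem v t).
Proof.
move=> vt /andP[/and3P[t_sorted tA /eqP t_sum] t_size].
have /perm_sumn/= sumE := perm_to_rem vt.
apply/andP; split; last by rewrite size_rem //; case: (t) vt t_size.
apply/and3P; split.
- exact: (subseq_sorted leq_trans (rem_subseq v t)).
- by apply/allP => x /mem_rem; move: x; apply/allP.
- by rewrite -t_sum sumE addKn.
Qed.

(** A partition is determined by what is left of it after removing [k] copies of
    a fixed part [v], since it is sorted.  So a bound for partitions into at most
    [n] parts, valid whatever their sum, carries over to partitions into at most
    [n + k] parts that contain [v] at least [k] times. *)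
Lemma size_remove_copies A v k n b (bound : forall m (L : seq (seq nat)),
    uniq L -> all (partition_upto m n A) L -> size L <= b) :
  forall m (L : seq (seq nat)), uniq L -> all (partition_upto m (n + k) A) L ->
    all (fun t => k <= count_mem v t) L -> size L <= b.
Proof.
elim: k => [|k IHk] m L L_uniq /allP L_part /allP L_count.
  by apply: (bound m) => //; apply/allP => t /L_part; rewrite addn0.
have vL t : t \in L -> v \in t.
  by move=> /L_count tk; rewrite -has_pred1 has_count; apply: leq_trans tk.
have permE t tL := perm_to_rem (vL t tL).
rewrite -(size_map (rem v)); apply: (IHk (m - v)).
- rewrite map_inj_in_uniq // => s t sL tL rem_eq.
  have /andP[s_part _] := L_part s sL; have /andP[t_part _] := L_part t tL.
  apply: (sorted_partition_inj s_part t_part).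
  apply: (perm_trans (permE s sL)).
  by rewrite rem_eq perm_sym permE.
- apply/allP => _ /mapP[t tL ->]; apply: partition_upto_rem (vL t tL) _.
  by rewrite -addnS L_part.
- apply/allP => _ /mapP[t tL ->].
  have /permP/(_ (pred1 v))/= := permE t tL.
  by rewrite eqxx add1n => E; have := L_count t tL; rewrite E.
Qed.

Lemma size_empty_partitions (L : seq (seq nat)) :
  uniq L -> all (@nilp nat) L -> size L <= 1.
Proof.
move=> L_uniq /allP L_nil; apply: (@uniq_leq_size _ L [:: [::]]) => // t /L_nil.
by move=> /nilP->; rewrite inE.
Qed.

(** * Parts with the growth condition *)

Section GrowingParts.

Context (A : {pred nat}) (N : option nat) (a : nat -> nat).
Hypothesis A_pos : forall x, x \in A -> 0 < x.
Hypothesis A_enum : increasing_enum A N a.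
Hypothesis a_growth : forall s, 2 <= s -> index_of N s ->
  \sum_(1 <= i < s) 2 * i * a (s - i) < a s.

(** This bounds the indices of the parts that are at most [m], so that there is a
    largest one, also when [A] is infinite. *)
Lemma index_le_part s : index_of N s -> s <= a s.
Proof.
have [_ a_incr] := A_enum.
elim: s => [|[|s] IHs] // s_idx.
  by apply: A_pos; apply/(A_enum.1 _); exists 1.
have s_idx' : index_of N s.+1.
  by move: s_idx; rewrite /index_of; case: N => //= k /ltnW.
exact: leq_ltn_trans (IHs s_idx') (a_incr _ _ s_idx' s_idx _).
Qed.

Lemma exists_largest_part m x : x \in A -> x <= m ->
  exists s, [/\ index_of N s, a s <= m &
    forall y, y \in A -> y <= m -> exists2 i, i < s & y = a (s - i)].
Proof.
move=> xA xm; have [A_idx _] := A_enum.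
pose Q s := index_of N s && (a s <= m).
have exQ : exists s, Q s.
  have [s s_idx as_x] := (A_idx x).1 xA.
  by exists s; rewrite /Q s_idx as_x.
have maxQ s : Q s -> s <= m.
  by move=> /andP[/index_le_part + ]; apply: leq_trans.
case: (ex_maxnP exQ maxQ) => s /andP[s_idx as_m] s_max.
exists s; split=> // y /A_idx[j j_idx <-] aj_m.
have js : j <= s by apply: s_max; rewrite /Q j_idx.
exists (s - j); last by rewrite subKn.
by move: j_idx => /andP[j_gt0 _]; lia.
Qed.

(** Otherwise the sum of [t] would be at most
    [\sum_(0 <= i < s) 2 * i * a (s - i)], which the growth condition makes
    smaller than [a s], hence smaller than [m]. *)
Lemma pigeonhole_part m s t : index_of N s -> a s <= m -> 0 < m ->
    (forall y, y \in A -> y <= m -> exists2 i, i < s & y = a (s - i)) ->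
    is_partition m A t ->
  has (fun i => 2 * i < count_mem (a (s - i)) t) (index_iota 0 s).
Proof.
move=> s_idx as_m m_gt0 parts /and3P[_ /allP tA /eqP t_sum].
apply/negPn/negP => /hasPn few.
have sub_t : {subset t <= [seq a (s - i) | i <- index_iota 0 s]}.
  move=> y yt; have y_m : y <= m.
    by rewrite -t_sum (perm_sumn (perm_to_rem yt)) leq_addr.
  have [i i_s ->] := parts y (tA y yt) y_m.
  by apply: map_f; rewrite mem_index_iota.
have := sumn_le_counts sub_t; rewrite t_sum big_map leqNgt => /negP; apply.
have le_sum : \sum_(i <- index_iota 0 s) count_mem (a (s - i)) t * a (s - i)
              <= \sum_(0 <= i < s) 2 * i * a (s - i).
  rewrite big_seq [leqRHS]big_seq leq_sum // => i /few.
  by rewrite -leqNgt leq_mul2r orbC => ->.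
apply: leq_ltn_trans le_sum _.
(* The term of index [0] vanishes, which leaves the sum of the growth condition;
   for [s = 1] nothing is left, and [m > 0] is what gives the contradiction. *)
case: s s_idx as_m {parts few sub_t} => [|s] // s_idx as_m.
rewrite big_ltn // muln0 mul0n add0n.
case: s s_idx as_m => [|s] s_idx as_m; first by rewrite big_geq.
exact: leq_trans (a_growth _ s_idx) as_m.
Qed.

(** The induction on [n] is for all sums [m] at once, because removing copies of a
    part decreases the sum, possibly to [0]. *)
Lemma size_partitions_le m n (L : seq (seq nat)) :
  uniq L -> all (partition_upto m n A) L -> size L <= fib_bound n.
Proof.
elim/ltn_ind: n m L => n IHn m L L_uniq L_part.
(* If [n] or [m] is [0], only the empty partition is possible. *)
have [n0|n_gt0] := posnP n.
  rewrite n0 in L_part *; apply: size_empty_partitions => //.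
  by apply: sub_all L_part => t /andP[_]; rewrite leqn0.
have [m0|m_gt0] := posnP m.
  apply: leq_trans (leq_maxl _ _); apply: size_empty_partitions => //.
  apply: sub_all L_part => -[|x t] // /andP[/and3P[_ /= /andP[xA _]]].
  by have := A_pos xA; rewrite m0; lia.
rewrite fib_boundE //.
have [-> //|] := eqVneq L [::].
rewrite -size_eq0 -lt0n -has_predT => /hasP[t0 t0L _].
have [x xA x_m] : exists2 x, x \in A & x <= m.
  move/allP/(_ t0 t0L): L_part => /andP[/and3P[_]].
  case: t0 {t0L} => [|x t] /=; first by move=> _ /eqP; lia.
  by move=> /andP[xA _] /eqP <- _; exists x => //; rewrite leq_addr.
have [s [s_idx as_m parts]] := exists_largest_part xA x_m.
pose Q i (t : seq nat) := 2 * i < count_mem (a (s - i)) t.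
have cover : all (fun t => has (Q^~ t) (index_iota 0 s)) L.
  apply: sub_all L_part => t /andP[t_part _].
  exact: pigeonhole_part s_idx as_m m_gt0 parts t_part.
apply: leq_trans (size_le_sum_count cover) _.
apply: leq_trans (sum_fib_bound s n).
rewrite [leqRHS]big_mkcond leq_sum // => i _.
rewrite -size_filter.
have LQ_part : all (partition_upto m n A) (filter (Q i) L).
  by rewrite all_filter; apply: sub_all L_part => t /= ->; rewrite implybT.
have LQ_count := filter_all (Q i) L.
(* A partition with more than [n] copies of a part has too many parts. *)
case: ltnP => [i_n|n_i]; last first.
  rewrite leqNgt -has_predT; apply/negP => /hasP[t tL _].
  move/allP/(_ t tL): LQ_part => /andP[_ t_n].
  move/allP/(_ t tL): LQ_count => t_i.
  have := leq_ltn_trans n_i (leq_trans t_i (leq_trans (count_size _ _) t_n)).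
  by rewrite ltnn.
apply: (@size_remove_copies A (a (s - i)) (2 * i).+1 (n - (2 * i).+1) _ _ m).
- by move=> m' L'; apply: IHn; lia.
- exact: filter_uniq.
- by rewrite subnK.
- exact: LQ_count.
Qed.

End GrowingParts.

(** * From tuples to sequences *)

(** Removing copies of a part changes both the number of parts and the sum, hence
    both parameters of the tuple types in [P]; plain sequences avoid this. *)
Lemma partition_list m n (A : {pred nat}) :
  exists L : seq (seq nat),
    [/\ uniq L, all (partition_upto m n A) L & size L = P m n A].
Proof.
have [L] : exists L : seq (seq nat), [/\ uniq L,
    all (fun t => is_partition m A t && (size t < n.+1)) L & size L = P m n A].
  rewrite /P; elim: n.+1 => [|k [L [L_uniq L_part L_size]]].
    by exists [::]; rewrite big_ord0.
  rewrite big_ord_recr /= -{}L_size cardE.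
  set E := enum _; pose f (s : k.-tuple 'I_m.+1) := [seq val i | i <- s].
  have f_inj : injective f by move=> s t /(inj_map val_inj)/val_inj.
  exists (L ++ map f E); split; last by rewrite size_cat size_map.
    rewrite cat_uniq L_uniq map_inj_uniq // enum_uniq andbT /=.
    apply/hasPn => _ /mapP[s _ ->]; apply/negP => /(allP L_part)/andP[_].
    by rewrite size_map size_tuple ltnn.
  rewrite all_cat; apply/andP; split.
    by apply: sub_all L_part => t /andP[-> /ltnW].
  apply/allP => _ /mapP[s + ->]; rewrite mem_enum inE => ->.
  by rewrite size_map size_tuple ltnSn.
by exists L.
Qed.

Theorem theorem2p2 (A : {pred nat}) (N : option nat) (a : nat -> nat)
  (A_pos : forall x, x \in A -> 0 < x)
  (A_enum : increasing_enum A N a)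
  (a_growth : forall s, 2 <= s -> index_of N s ->
     \sum_(1 <= i < s) 2 * i * a (s - i) < a s)
  (m n : nat) (m_pos : 0 < m) (n_pos : 0 < n) :
  P m n A <= F n.
Proof.
have [L [L_uniq L_part <-]] := partition_list m n A.
rewrite -fib_boundE //.
exact: (size_partitions_le A_pos A_enum a_growth L_uniq L_part).
Qed.
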